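(* Let $G$ be a graph on $n$ vertices, let $l_{ij}$ denote the $(i,j)$-th entry of its Lanzhou matrix $A_{Lz}(G)$, and let $P = 2\sum_{i<j} l_{ij}^2$. Let $S(A_{Lz}(G))$ be the spread of the Lanzhou matrix. Then $$S(A_{Lz}(G)) \geq \sqrt{\frac{4P}{n}}.$$
   Context: Graphs are finite, simple and undirected. For a graph $G$ on $n$ vertices, $d_G(u)$ is the degree of $u$ in $G$ and $d_{\overline{G}}(u)=n-1-d_G(u)$ is its degree in the complement $\overline{G}$. The Lanzhou matrix $A_{Lz}(G)$ is the real symmetric $n\times n$ matrix indexed by vertices whose $(u,v)$ entry is $d_G(u)d_{\overline{G}}(u)+d_G(v)d_{\overline{G}}(v)$ if $u$ and $v$ are adjacent in $G$, and $0$ otherwise. Its eigenvalues are $\lambda_1\geq\lambda_2\geq\cdots\geq\lambda_n$ (the Lanzhou eigenvalues of $G$). The spread is $S(A_{Lz}(G))=\lambda_1-\lambda_n$. *)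

(* Defs.v *)
From mathcomp Require Import all_boot all_order all_algebra.
From mathcomp Require Import polyrcf.

Set Implicit Arguments.
Unset Strict Implicit.
Unset Printing Implicit Defensive.

Import Order.TTheory GRing.Theory Num.Theory.
Local Open Scope ring_scope.

Record sgraph (n : nat) := SGraph {
  adj :> rel 'I_n;
  adj_sym : symmetric adj;
  adj_irr : irreflexive adj
}.

Definition compl_rel n (G : sgraph n) : rel 'I_n :=
  fun u v => (u != v) && ~~ G u v.

Lemma compl_sym n (G : sgraph n) : symmetric (compl_rel G).
Proof. by move=> u v; rewrite /compl_rel eq_sym adj_sym. Qed.

Lemma compl_irr n (G : sgraph n) : irreflexive (compl_rel G).
Proof. by move=> u; rewrite /compl_rel eqxx. Qed.

Definition compl n (G : sgraph n) : sgraph n :=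
  SGraph (compl_sym G) (compl_irr G).

Definition deg n (G : sgraph n) (u : 'I_n) : nat := #|[set v | G u v]|.

Lemma deg_compl n (G : sgraph n) (u : 'I_n) :
  deg (compl G) u = (n - 1 - deg G u)%N.
Proof.
have -> : deg (compl G) u = #|[set~ u] :\: [set v | G u v]|.
  by apply: eq_card => v; rewrite !inE /= /compl_rel eq_sym andbC.
have sub : [set v | G u v] \subset [set~ u].
  by apply/subsetP => v; rewrite !inE; apply: contraTneq => ->; rewrite adj_irr.
by rewrite cardsD (setIidPr sub) cardsC1 card_ord subn1.
Qed.

Definition lanzhou_mx (R : rcfType) n (G : sgraph n) : 'M[R]_n :=
  \matrix_(u, v)
    if G u v then
      (deg G u * deg (compl G) u + deg G v * deg (compl G) v)%:R
    else 0.

(* The roots in R of the characteristic polynomial, each repeated according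
   to its multiplicity, in nonincreasing order.  A symmetric A : 'M[R]_n has
   all its n eigenvalues in R, and then this is lambda_1, ..., lambda_n. *)
Definition eigenvalues (R : rcfType) n (A : 'M[R]_n) : seq R :=
  let p := char_poly A in
  sort >=%R (flatten [seq nseq (mup x p) x | x <- rootsR p]).

Lemma eigenvalues_unique (R : rcfType) n (A : 'M[R]_n) (s : seq R) :
  sorted >=%R s -> char_poly A = \prod_(x <- s) ('X - x%:P) ->
  eigenvalues A = s.
Proof.
move=> s_sorted pE.
apply: (sorted_eq ge_trans ge_anti) => //.
  by apply: sort_sorted => x y; exact: le_total.
rewrite perm_sort; apply/allP => /= x _; apply/eqP.
have p0 : char_poly A != 0 by rewrite monic_neq0 // char_poly_monic.
have <- : mup x (char_poly A) = count_mem x s by rewrite pE mu_prod_XsubC.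
have xr : (x \in rootsR (char_poly A)) = root (char_poly A) x.
  by have := roots_on_rootsR p0 x; rewrite in_itv.
have uniq_r : uniq (rootsR (char_poly A)) by exact: uniq_roots.
rewrite count_flatten -map_comp sumnE big_map.
under eq_bigr => y _ do rewrite /= count_nseq /=.
have [xin|xnin] := boolP (x \in rootsR (char_poly A)).
  rewrite (bigD1_seq x) //= eqxx mul1n big1 ?addn0 // => y /negPf ->.
  by rewrite mul0n.
rewrite mupNroot -?xr // big1_seq // => y /andP[_ yin].
by case: eqP yin xnin => [->|] => [->|]; rewrite ?mul0n.
Qed.

(* With 0-based indexing, lambda_1 and lambda_n are at positions 0 and n - 1. *)
Definition spread (R : rcfType) n (A : 'M[R]_n) : R :=
  (eigenvalues A)`_0 - (eigenvalues A)`_(n - 1).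

(* Main.v *)
(** By the spectral theorem the eigenvalues [d i] of a real symmetric matrix
    [A] satisfy [\sum_i d i = \tr A] and [\sum_i d i ^+ 2 = \tr (A *m A)].
    For the Lanzhou matrix the first sum vanishes and the second is [P].
    Summing [(d i - a) * (d i - b) <= 0], where [a] and [b] are the extreme
    eigenvalues, gives [P + n a b <= 0], and [- a b <= (a - b)^2 / 4]. *)
Require Import Defs.
From mathcomp Require Import all_boot all_order all_algebra.
From mathcomp Require Import complex ring lra.
Import Order.TTheory GRing.Theory Num.Theory.
Local Open Scope ring_scope.

(** Viewed as constant polynomial matrices, [P] and its inverse conjugate [char_poly_mx A] while
    fixing the scalar matrix of 'X; the determinant does not see the conjugation. *)
Lemma char_poly_conj (F : fieldType) (n : nat) (P A : 'M[F]_n) :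
  P \in unitmx -> char_poly (invmx P *m A *m P) = char_poly A.
Proof.
move=> Pu; pose p := map_mx polyC P; pose q := map_mx polyC (invmx P).
have qp : q *m p = 1%:M by rewrite -map_mxM mulVmx // map_mx1.
rewrite /char_poly.
have -> : char_poly_mx (invmx P *m A *m P) = q *m char_poly_mx A *m p.
  rewrite /char_poly_mx !map_mxM mulmxBr mulmxBl; congr (_ - _).
  by rewrite mul_mx_scalar -scalemxAl qp scalemx1.
by rewrite !det_mulmx mulrAC -det_mulmx qp det1 mul1r.
Qed.

(** Over R[i] the matrix is Hermitian, hence unitarily diagonalizable with real eigenvalues. The
    three identities are proved there and pulled back along the injection of R into R[i]. *)
Lemma symmetric_spectrum (R : rcfType) (n : nat) (A : 'M[R]_n) :
  A^T = A ->
  exists d : 'I_n -> R,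
    [/\ char_poly A = \prod_i ('X - (d i)%:P),
        \tr A = \sum_i d i
      & \tr (A *m A) = \sum_i d i ^+ 2].
Proof.
move=> As; pose f : {rmorphism R -> R[i]} := real_complex R; pose B := map_mx f A.
have Breal : B \is a mxOver Num.real.
  by apply/mxOverP => i j; rewrite mxE; apply/complex_realP; exists (A i j).
have Bherm : B \is hermsymmx.
  apply: realsym_hermsym => //; apply/is_hermitianmxP.
  by rewrite expr0 scale1r map_mx_id // /B map_trmx As.
have /orthomx_spectralP BE := hermitian_normalmx Bherm.
have /mxOverP Dreal := hermitian_spectral_diag_real Bherm.
have Pu := spectral_unit B.
move: (spectralmx B) (spectral_diag B) BE Dreal Pu => P D BE Dreal Pu.
(* Since the entries of [D] are real, taking real parts loses nothing. *)
pose d i := complex.Re (D 0 i); exists d.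
have dE i : f (d i) = D 0 i by exact: RRe_real.
have fI : injective f by exact: fmorph_inj.
split.
- apply: (map_poly_inj f).
  rewrite map_char_poly -/B BE char_poly_conj // char_poly_trig ?diag_mx_is_trig //.
  rewrite rmorph_prod; apply: eq_bigr => i _.
  by rewrite rmorphB /= map_polyX map_polyC mxE eqxx mulr1n -dE.
(* Cyclicity of the trace brings [P] next to its inverse, leaving the trace of the diagonal
   matrix. *)
- apply: fI; rewrite -trace_map_mx -/B BE mxtrace_mulC mulmxA mulmxV // mul1mx.
  by rewrite mxtrace_diag rmorph_sum; apply: eq_bigr => i _; rewrite dE.
- apply: fI; rewrite -trace_map_mx map_mxM -/B BE.
  rewrite -!mulmxA (mulmxA P) mulmxV // mul1mx mxtrace_mulC -!mulmxA mulmxV //.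
  rewrite mulmx1 mulmx_diag mxtrace_diag rmorph_sum.
  by apply: eq_bigr => i _; rewrite mxE -dE rmorphXn expr2.
Qed.

Lemma eigenvalues_split (R : rcfType) (n : nat) (A : 'M[R]_n) (d : 'I_n -> R) :
  char_poly A = \prod_i ('X - (d i)%:P) ->
  eigenvalues A = sort >=%R [seq d i | i <- enum 'I_n].
Proof.
move=> cE; apply: eigenvalues_unique.
  by apply: sort_sorted => x y; exact: le_total.
rewrite (perm_big [seq d i | i <- enum 'I_n]) ?perm_sort //=.
by rewrite big_map big_enum.
Qed.

Lemma eigenvalues_extreme (R : rcfType) (n : nat) (A : 'M[R]_n)
    (d : 'I_n -> R) (i : 'I_n) :
  char_poly A = \prod_i ('X - (d i)%:P) ->
  (eigenvalues A)`_(n - 1) <= d i <= (eigenvalues A)`_0.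
Proof.
move=> /eigenvalues_split ->; set s := sort _ _.
have s_sorted : sorted >=%R s by apply: sort_sorted => x y; exact: le_total.
have size_s : size s = n by rewrite size_sort size_map size_enum_ord.
have di : d i \in s by rewrite mem_sort map_f // mem_enum.
have lt_k : (index (d i) s < n)%N by rewrite -size_s index_mem.
have n_gt0 : (0 < n)%N by exact: leq_trans lt_k.
have leP := sorted_leq_nth ge_trans (fun x => lexx x) 0 s_sorted.
(* With [d i] at position k of the nonincreasing list [s], both bounds follow from 0 <= k <= n -
   1. *)
rewrite -[d i](nth_index 0 di); apply/andP; split; apply: leP;
  rewrite ?inE ?size_s ?subn1 ?prednK //.
by rewrite -ltnS prednK.
Qed.

Lemma sum_sqr_le_spread (R : realFieldType) (n : nat) (d : 'I_n -> R) (a b : R) :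
  (forall i, b <= d i <= a) -> \sum_i d i = 0 ->
  4 * \sum_i d i ^+ 2 <= n%:R * (a - b) ^+ 2.
Proof.
move=> dP d0.
have : \sum_i (d i - a) * (d i - b) <= 0.
  apply: sumr_le0 => i _; have /andP[bd da] := dP i.
  by rewrite mulr_le0_ge0 ?subr_le0 ?subr_ge0.
have -> : \sum_i (d i - a) * (d i - b) = \sum_i d i ^+ 2 + n%:R * (a * b).
  transitivity (\sum_i (d i ^+ 2 - (a + b) * d i + a * b)).
    by apply: eq_bigr => i _; ring.
  rewrite !big_split /= sumrN -mulr_sumr d0 mulr0 subr0.
  by rewrite sumr_const card_ord mulr_natl.
(* This is the slack in the bound on -ab: (a - b)^2 + 4ab = (a + b)^2. *)
have : 0 <= n%:R * (a + b) ^+ 2 by rewrite mulr_ge0 ?sqr_ge0.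
by nra.
Qed.

Lemma sqrt_trace_le_spread (R : rcfType) (n : nat) (A : 'M[R]_n) :
  A^T = A -> \tr A = 0 -> Num.sqrt (4 * \tr (A *m A) / n%:R) <= spread A.
Proof.
move=> /symmetric_spectrum[d [cE -> ->]] d0.
have dP i := @eigenvalues_extreme R n A d i cE.
(* For n = 0, division by zero gives 0 under the root, and both terms of [spread] are the same
   default value. *)
case: n => [|n] in A d cE d0 dP *.
  by rewrite invr0 mulr0 sqrtr0 /spread subrr.
have spread_ge0 : 0 <= spread A.
  by have /andP[h1 h2] := dP ord0; rewrite subr_ge0 (le_trans h1).
rewrite -[leRHS]ger0_norm // -sqrtr_sqr ler_wsqrtr //.
by rewrite ler_pdivrMr ?ltr0Sn // [leRHS]mulrC; exact: sum_sqr_le_spread.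
Qed.

(** By symmetry the trace is the sum of all squared entries; the diagonal contributes nothing and
    the two triangles contribute equally. *)
Lemma mxtrace_sqr_symmetric (R : comNzRingType) (n : nat) (A : 'M[R]_n) :
  A^T = A -> (forall i, A i i = 0) ->
  \tr (A *m A) = 2 * \sum_(i < n) \sum_(j < n | (i < j)%N) A i j ^+ 2.
Proof.
move=> As A0; have Aji i j : A j i = A i j by rewrite -[in LHS]As mxE.
transitivity (\sum_(i < n) (\sum_(j < n | (i < j)%N) A i j ^+ 2 +
                      \sum_(j < n | (j < i)%N) A i j ^+ 2)).
  apply: eq_bigr => i _; rewrite mxE (bigID (fun j : 'I_n => (i < j)%N)) /=.
  congr (_ + _); first by apply: eq_bigr => j _; rewrite Aji expr2.
  rewrite (bigD1 i) ?ltnn //= A0 mul0r add0r.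
  apply: eq_big => [j|j _]; last by rewrite Aji expr2.
  by rewrite -leqNgt ltn_neqAle andbC.
rewrite big_split /= mulr_natl mulr2n; congr (_ + _).
(* Swapping the summation order turns the lower triangle into the upper one. *)
rewrite (exchange_big_dep predT) //=.
by apply: eq_bigr => j _; apply: eq_bigr => i _; rewrite Aji.
Qed.

Lemma lanzhou_mx_sym (R : rcfType) (n : nat) (G : sgraph n) :
  (lanzhou_mx R G)^T = lanzhou_mx R G.
Proof. by apply/matrixP => i j; rewrite !mxE adj_sym addnC. Qed.

Lemma lanzhou_mx_diag (R : rcfType) (n : nat) (G : sgraph n) (i : 'I_n) :
  lanzhou_mx R G i i = 0.
Proof. by rewrite mxE adj_irr. Qed.

Theorem theorem22 (R : rcfType) (n : nat) (G : sgraph n) :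
  let l := lanzhou_mx R G in
  let P := 2 * \sum_(i < n) \sum_(j < n | (i < j)%N) l i j ^+ 2 in
  spread l >= Num.sqrt (4 * P / n%:R).
Proof.
have ls := lanzhou_mx_sym R n G; have l0 := lanzhou_mx_diag R n G.
cbv zeta; rewrite -mxtrace_sqr_symmetric //; apply: sqrt_trace_le_spread => //.
exact: big1.
Qed.
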